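(* Let $\Omega_c$ be a commutative semigroup and let $(A,\prec_\omega,\succ_\omega,\Omega_c)$ be a pre-anti-flexible family algebra. For all $x,y\in A$ and $\omega\in\Omega_c$ define $$x\triangleright_\omega y := x\succ_\omega y - y\prec_\omega x,\qquad x\triangleleft_\omega y := x\prec_\omega y - y\succ_\omega x .$$ Then $(A,\triangleright_\omega,\Omega_c)$ is a left pre-Lie family algebra and $(A,\triangleleft_\omega,\Omega_c)$ is a right pre-Lie family algebra.
   Context: Standing conventions: $\Omega_c$ is a commutative associative semigroup; $A$ is a finite-dimensional vector space over a field of characteristic zero; all operations on $A$ are bilinear. A pre-anti-flexible family algebra $(A,\prec_\omega,\succ_\omega,\Omega_c)$ is a vector space $A$ with bilinear operations $\prec_\alpha,\succ_\alpha:A\times A\to A$ for each $\alpha\in\Omega_c$ such that for all $x,y,z\in A$ and $\alpha,\beta\in\Omega_c$: $$(x\succ_\alpha y)\prec_\beta z - x\succ_\alpha(y\prec_\beta z) = (z\succ_\beta y)\prec_\alpha x - z\succ_\beta(y\prec_\alpha x),$$ $$(x\succ_\alpha y + x\prec_\beta y)\succ_{\alpha\beta}z - x\succ_\alpha(y\succ_\beta z) = (z\prec_\beta y)\prec_\alpha x - z\prec_{\beta\alpha}(y\succ_\beta x + y\prec_\alpha x).$$ A left pre-Lie family algebra is a vector space $A$ with bilinear operations $\triangleright_\omega$ ($\omega\in\Omega_c$) such that for all $x,y,z\in A$, $\alpha,\beta\in\Omega_c$: $$(x\triangleright_\alpha y)\triangleright_{\alpha\beta}z - x\triangleright_\alpha(y\triangleright_\beta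 z) = (y\triangleright_\beta x)\triangleright_{\beta\alpha}z - y\triangleright_\beta(x\triangleright_\alpha z).$$ A right pre-Lie family algebra is a vector space $A$ with bilinear operations $\triangleleft_\omega$ ($\omega\in\Omega_c$) such that for all $x,y,z\in A$, $\alpha,\beta\in\Omega_c$: $$x\triangleleft_{\alpha\beta}(y\triangleleft_\beta z) - (x\triangleleft_\alpha y)\triangleleft_\beta z = x\triangleleft_{\beta\alpha}(z\triangleleft_\alpha y) - (x\triangleleft_\beta z)\triangleleft_\alpha y.$$ *)

(* Defs.v *)
From mathcomp Require Import all_boot all_algebra.

Set Implicit Arguments.
Unset Strict Implicit.
Unset Printing Implicit Defensive.

Import GRing.Theory.
Local Open Scope ring_scope.

(* The Prop-valued unfolding of the library's Type-valued [bilinear_for]. *)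
Definition bilinear_op (K : fieldType) (A : lmodType K) (f : A -> A -> A) : Prop :=
  (forall (y : A) (c : K) (u v : A), f (c *: u + v) y = c *: f u y + f v y) /\
  (forall (x : A) (c : K) (u v : A), f x (c *: u + v) = c *: f x u + f x v).

Section FamilyAlgebras.

Variables (Omega : semigroupType) (K : fieldType) (A : lmodType K).
Implicit Types (prec succ tri : Omega -> A -> A -> A).

Record pre_anti_flexible_family prec succ : Prop := PreAntiFlexibleFamily {
  paf_prec_bilinear : forall a, bilinear_op (prec a);
  paf_succ_bilinear : forall a, bilinear_op (succ a);
  paf_axiom1 : forall (x y z : A) (a b : Omega),
    prec b (succ a x y) z - succ a x (prec b y z)
    = prec a (succ b z y) x - succ b z (prec a y x);
  paf_axiom2 : forall (x y z : A) (a b : Omega),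
    succ (a * b)%g (succ a x y + prec b x y) z - succ a x (succ b y z)
    = prec a (prec b z y) x - prec (b * a)%g z (succ b y x + prec a y x)
}.

Record left_pre_Lie_family tri : Prop := LeftPreLieFamily {
  lpl_bilinear : forall a, bilinear_op (tri a);
  lpl_axiom : forall (x y z : A) (a b : Omega),
    tri (a * b)%g (tri a x y) z - tri a x (tri b y z)
    = tri (b * a)%g (tri b y x) z - tri b y (tri a x z)
}.

Record right_pre_Lie_family tri : Prop := RightPreLieFamily {
  rpl_bilinear : forall a, bilinear_op (tri a);
  rpl_axiom : forall (x y z : A) (a b : Omega),
    tri (a * b)%g x (tri b y z) - tri b (tri a x y) z
    = tri (b * a)%g x (tri a z y) - tri a (tri b x z) y
}.

End FamilyAlgebras.

(* Main.v *)
Require Import Defs.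
From mathcomp Require Import all_boot all_algebra.

(** Write [x |> y = succ x y - prec y x] and [x <| y = prec x y - succ y x], so that
    [x <| y = - (y |> x)] for each index. Let [d1(x,y,z;a,b)] and [d2(x,y,z;a,b)]
    be the differences of the two sides of the first and second axioms
    of a pre-anti-flexible family algebra. The difference of the two sides of the left
    pre-Lie axiom at [(x,y,z;a,b)] is
    [d2(x,y,z;a,b) - d2(y,x,z;b,a) - d1(x,z,y;a,b)], hence it vanishes. The right
    pre-Lie axiom for [<|] at [(x,y,z;a,b)] is the left one for [|>] at
    [(z,y,x;b,a)], because the two signs cancel in every double product. *)

Set Implicit Arguments.
Unset Strict Implicit.
Unset Printing Implicit Defensive.

Import GRing.Theory.
Local Open Scope ring_scope.

Section BilinearOp.

Variables (K : fieldType) (A : lmodType K).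
Implicit Types f g : A -> A -> A.

Lemma bilinear_opDl f : bilinear_op f -> forall y, {morph f^~ y : u v / u + v}.
Proof. by move=> [fl _] y u v; rewrite -[u]scale1r fl !scale1r. Qed.

Lemma bilinear_opDr f : bilinear_op f -> forall x, {morph f x : u v / u + v}.
Proof. by move=> [_ fr] x u v; rewrite -[u]scale1r fr !scale1r. Qed.

Lemma bilinear_opBl f : bilinear_op f -> forall y, {morph f^~ y : u v / u - v}.
Proof.
(* Linearity at the scalar -1, applied to [(-1) *: v + u]. *)
by move=> [fl _] y u v; rewrite addrC -scaleN1r fl scaleN1r addrC.
Qed.

Lemma bilinear_opBr f : bilinear_op f -> forall x, {morph f x : u v / u - v}.
Proof.
by move=> [_ fr] x u v; rewrite addrC -scaleN1r fr scaleN1r addrC.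
Qed.

Lemma bilinear_opNl f : bilinear_op f -> forall y, {morph f^~ y : u / - u}.
Proof.
move=> /bilinear_opBl fB y u.
by rewrite -sub0r fB -(subrr u) fB subrr sub0r.
Qed.

Lemma bilinear_opNr f : bilinear_op f -> forall x, {morph f x : u / - u}.
Proof.
move=> /bilinear_opBr fB x u.
by rewrite -sub0r fB -(subrr u) fB subrr sub0r.
Qed.

(** Linearity in one slot uses [f] in that slot and [g] in the other. *)
Lemma bilinear_op_sub_flip f g :
  bilinear_op f -> bilinear_op g -> bilinear_op (fun x y => f x y - g y x).
Proof.
move=> [fl fr] [gl gr].
by split=> x c u v; rewrite (fl, fr) (gl, gr) scalerBr opprD addrACA.
Qed.

End BilinearOp.

Section FamilyAlgebras.

Variables (Omega : semigroupType) (K : fieldType) (A : lmodType K).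
Hypothesis Omega_comm : forall a b : Omega, (a * b)%g = (b * a)%g.
Implicit Types (prec succ tri : Omega -> A -> A -> A).

Lemma pre_anti_flexible_left_pre_Lie prec succ :
  pre_anti_flexible_family prec succ ->
  left_pre_Lie_family (fun w x y => succ w x y - prec w y x).
Proof.
case=> precP succP ax1 ax2; split=> [a|x y z a b].
  exact: bilinear_op_sub_flip.
have d1 := ax1 x z y a b; have d2 := ax2 x y z a b; have d2' := ax2 y x z b a.
move: d1 d2 d2'; rewrite (Omega_comm b a).
rewrite !(bilinear_opBl (precP _)) !(bilinear_opBr (precP _)).
rewrite !(bilinear_opBl (succP _)) !(bilinear_opBr (succP _)).
rewrite !(bilinear_opDr (precP _)) !(bilinear_opDl (succP _)).
move=> /eqP; rewrite -subr_eq0 => /eqP d1.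
move=> /eqP; rewrite -subr_eq0 => /eqP d2.
move=> /eqP; rewrite -subr_eq0 => /eqP d2'.
apply/eqP; rewrite -subr_eq0; apply/eqP.
(* The three zeros stand for [d2], [d2'] and [d1], in this order. *)
transitivity (0 - 0 - 0 : A); last by rewrite !subr0.
rewrite -{1}d2 -{1}d2' -d1 !(opprD, opprK) !addrA.
(* Nothing cancels: the 16 signed terms on the left are reordered into the 6, 6 and 4 terms of [d2],
   [d2'] and [d1]. *)
by rewrite [LHS](ACl (1*10*5*8*11*4*9*2*13*16*3*12*15*6*7*14)).
Qed.

Lemma left_pre_Lie_opp_right tri :
  left_pre_Lie_family tri -> right_pre_Lie_family (fun w x y => - tri w y x).
Proof.
case=> triP ax; split=> [a|x y z a b].
  have [tl tr] := triP a.
  by split=> x c u v; rewrite (tl, tr) opprD scalerN.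
rewrite !(bilinear_opNl (triP _)) !(bilinear_opNr (triP _)) !opprK.
(* [ax] at [(z,y,x;b,a)] expects the index [b * a] and returns [a * b]. *)
by rewrite (Omega_comm a b) ax (Omega_comm a b).
Qed.

End FamilyAlgebras.

Theorem theorem2p8 (Omega : semigroupType)
    (Omega_comm : forall a b : Omega, (a * b)%g = (b * a)%g)
    (K : fieldType) (K_char0 : [pchar K] =i pred0) (A : vectType K)
    (prec succ : Omega -> A -> A -> A) :
  pre_anti_flexible_family prec succ ->
  left_pre_Lie_family (fun w x y => succ w x y - prec w y x) /\
  right_pre_Lie_family (fun w x y => prec w x y - succ w y x).
Proof.
move=> /(pre_anti_flexible_left_pre_Lie Omega_comm) lpl; split=> //.
have [bil ax] := left_pre_Lie_opp_right Omega_comm lpl.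
(* The two forms of the right product agree pointwise by [opprB], so each field is transported
   separately. *)
split=> [a|x y z a b]; first by have [bl br] := bil a; split=> x c u v;
  rewrite -!(opprB (succ a _ _)) (bl, br).
by have := ax x y z a b; rewrite /= !opprB.
Qed.
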